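(* Let $n\geq 2$ and let $v_1,\ldots,v_n\colon[0,1]\to\mathbb{R}_{>0}$ be velocity functions such that each $v_i$ is continuous almost everywhere and there exist numbers $b,B$ with $0<b<v_i(x)<B<+\infty$ for all $x\in[0,1]$ and all $i$. Let $f\colon\triangle\to\triangle$ be the reset function of the bucket brigade with $n$ workers having these velocity functions, where $\triangle=\{(x_2,\ldots,x_n)\colon 0\leq x_2\leq\cdots\leq x_n\leq 1\}$. Then the fixed point of $f$ is unique: if $p,q\in\triangle$ satisfy $f(p)=p$ and $f(q)=q$, then $p=q$.
   Context: Bucket brigade (no-station setting). There are $n$ workers, numbered $1,\ldots,n$ along a production line identified with $[0,1]$. The state is a vector $(x_1,\ldots,x_n)$ with $0\leq x_1\leq x_2\leq\cdots\leq x_n\leq 1$, where $x_i$ is the position of worker $i$. Worker $i$ has a velocity function $v_i\colon[0,1]\to\mathbb{R}_{>0}$. All workers move forward. Worker $n$ at position $x$ has velocity $v_n(x)$. For $i<n$, worker $i$ at position $x$ has velocity $v_i(x)$ as long as he has not caught up with worker $i+1$. When he has caught up with worker $i+1$, he cannot overtake him and adjusts his velocity to that of worker $i+1$. Formally, the positions are Lipschitz functions $x_i(t)$ of the time $t\geq 0$ with $x_1(t)\leq\cdots\leq x_n(t)$ such that, for almost every $t$ with $x_n(t)<1$, $$\dot x_n=v_n(x_n),\qquad \dot x_i=\begin{cases} v_i(x_i) & \text{if } x_i<x_{i+1},\\ \min(v_i(x_i),\dot x_{i+1}) & \text{if } x_i=x_{i+1},\end{cases}\qquad i=1,\ldots,n-1.$$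 Reset. Let $T$ be the smallest $t\geq 0$ with $x_n(t)=1$. At time $T$ a reset occurs instantaneously: worker $i+1$ is sent to the position $x_i(T)$ for $i=1,\ldots,n-1$, and worker $1$ is sent to position $0$. Reset function. The reset function $f\colon\triangle\to\triangle$ maps $(x_2,\ldots,x_n)$ to $(x_2',\ldots,x_n')$, where, starting at time $0$ from the state $(0,x_2,\ldots,x_n)$, the state just after the first reset is $(0,x_2',\ldots,x_n')$. That is, $x'_{i+1}=x_i(T)$ for $i=1,\ldots,n-1$. (It is known that $f$ is continuous and has at least one fixed point.) *)

(* Defs.v *)
From mathcomp Require Export all_boot all_order all_algebra.
From mathcomp Require Export all_classical all_reals all_analysis.

Set Implicit Arguments.
Unset Strict Implicit.
Unset Printing Implicit Defensive.

Import Order.TTheory GRing.Theory Num.Theory.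
Import numFieldNormedType.Exports.

Local Open Scope classical_set_scope.
Local Open Scope ring_scope.

(* There are n = m.+1 workers: worker i (counted from 1, as in the mathematics)
   is the ordinal i - 1 of 'I_m.+1, so worker n is ord_max.  For j : 'I_m, the
   pair (behind j, ahead j) is the pair of consecutive workers (j + 1, j + 2). *)
Definition behind (m : nat) (j : 'I_m) : 'I_m.+1 := widen_ord (leqnSn m) j.
Definition ahead (m : nat) (j : 'I_m) : 'I_m.+1 := lift ord0 j.

Definition in_line_order (R : realType) (k : nat) (y : 'I_k -> R) : Prop :=
  (forall i, 0 <= y i <= 1) /\ (forall i j : 'I_k, (i <= j)%N -> y i <= y j).

(* Column j of a row vector p : 'rV_m is the coordinate called x_{j + 2}. *)
Definition triangle (R : realType) (m : nat) : set 'rV[R]_m :=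
  [set p | in_line_order (p ord0)].

Definition start_state (R : realType) (m : nat) (p : 'rV[R]_m) (i : 'I_m.+1) : R :=
  if unlift ord0 i is Some j then p ord0 j else 0.

(* Only the values of u on [0, 1] matter. *)
Definition ae_continuous01 (R : realType) (u : R -> R) : Prop :=
  {ae (@lebesgue_measure R), forall x : R, x \in `[0, 1] ->
     u @ within `[0, 1] (nbhs x) --> u x}.

(* x i t is the position of worker i at time t; only t >= 0 matters. *)
Definition is_trajectory (R : realType) (m : nat)
    (v : 'I_m.+1 -> R -> R) (x : 'I_m.+1 -> R -> R) : Prop :=
  [/\ forall i, [lipschitz x i t | t in `[0, +oo[],
      forall t, 0 <= t -> in_line_order (x ^~ t)
    & {ae (@lebesgue_measure R), forall t, 0 <= t -> x ord_max t < 1 ->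
        [/\ forall i, derivable (x i) t 1,
            derive1 (x ord_max) t = v ord_max (x ord_max t)
          & forall j : 'I_m,
              derive1 (x (behind j)) t =
                if x (behind j) t < x (ahead j) t then v (behind j) (x (behind j) t)
                else Num.min (v (behind j) (x (behind j) t)) (derive1 (x (ahead j)) t)]}].

Definition is_reset_time (R : realType) (m : nat)
    (x : 'I_m.+1 -> R -> R) (T : R) : Prop :=
  [/\ 0 <= T, x ord_max T = 1 & forall t, 0 <= t -> x ord_max t = 1 -> T <= t].

(* Under the hypotheses on v, v and p determine the trajectory up to time T, so p' is
   unique; the positions after that time are irrelevant. *)
Definition resets_to (R : realType) (m : nat) (v : 'I_m.+1 -> R -> R)
    (p p' : 'rV[R]_m) : Prop :=
  exists x T, [/\ is_trajectory v x, forall i, x i 0 = start_state p i,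
    is_reset_time x T & forall j, p' ord0 j = x (behind j) T].

Definition is_reset_function (R : realType) (m : nat) (v : 'I_m.+1 -> R -> R)
    (f : 'rV[R]_m -> 'rV[R]_m) : Prop :=
  forall p, triangle p -> resets_to v p (f p).

(* Main.v *)
Require Import Defs.
From mathcomp Require Import all_boot all_order all_algebra.
From mathcomp Require Import all_classical all_reals all_analysis.
From mathcomp Require Import lra zify.

(* At a fixed point, worker j+1 starts where worker j is at the reset.  Speeds being
   positive, worker j stays strictly behind that point before the reset, hence is
   never blocked, and each worker solves x_i' = v_i(x_i) almost everywhere.  For such
   an autonomous equation the time needed to travel between two positions does not
   depend on the solution.  Hence, comparing two fixed points with reset times S <= T
   worker after worker, the positions at the reset are ordered in the same way, and
   strictly so if S < T.  As the last worker is at 1 in both cases, S = T, and then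
   the comparison holds in both directions. *)

Set Implicit Arguments.
Unset Strict Implicit.
Unset Printing Implicit Defensive.

Import Order.TTheory GRing.Theory Num.Theory.
Import numFieldNormedType.Exports.

Local Open Scope classical_set_scope.
Local Open Scope ring_scope.

(** * Monotonicity from one-sided local conditions outside a small set *)

Lemma near_rightP (R : realType) (t : R) (P : R -> Prop) :
  (\forall u \near t^'+, P u) <->
  exists2 d, 0 < d & forall u, t < u -> u < t + d -> P u.
Proof.
split.
  move=> /nbhs_ballP[d d0 dP]; exists d => // u tu ud.
  by apply: dP => //; rewrite /ball /= ltr_distlC; lra.
case=> d d0 dP; apply/nbhs_ballP; exists d => // u.
by rewrite /ball /= ltr_distlC => /andP[_ ud] tu; exact: dP.
Qed.

(** Let [c] be the supremum of the points [t] with [g a <= g t]. The lower slope bound forbids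
    downward jumps, so [g a <= g c]; if [c < b], the condition to the right of [c] yields such a
    point beyond [c]. *)
Lemma creeping (R : realType) (g : R -> R) (K a b : R) : a <= b ->
  (forall s t, a <= s -> s <= t -> t <= b -> g s - K * (t - s) <= g t) ->
  (forall t, a <= t -> t < b -> \forall u \near t^'+, g t <= g u) ->
  g a <= g b.
Proof.
move=> ab gK gr.
have K0 : exists2 M, 0 < M &
    forall s t, a <= s -> s <= t -> t <= b -> g s - M * (t - s) <= g t.
  exists (`|K| + 1) => [|s t as_ st tb]; first by rewrite ltr_pwDr.
  apply: le_trans (gK _ _ as_ st tb); rewrite lerB// ler_wpM2r ?subr_ge0//.
  by rewrite (le_trans (ler_norm _))// lerDl.
case: K0 => M M0 gM {gK}.
pose S := [set t | a <= t <= b /\ g a <= g t].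
have Sa : S a by split=> //; rewrite lexx.
have Sb : has_ubound S by exists b => t [/andP[]].
have Ssup : has_sup S by split=> //; exists a.
pose c := sup S.
have ac : a <= c by exact: ub_le_sup.
have cb : c <= b by apply: ge_sup; [exists a|move=> t [/andP[]]].
have gc : g a <= g c.
  apply/ler_addgt0Pr => e e0.
  have [|t [/andP[at_ tb] gt] ct] := sup_adherent (eps := e / M) _ Ssup.
    by rewrite divr_gt0.
  have tc : t <= c by apply: ub_le_sup => //; split => //; rewrite at_.
  have := gM _ _ at_ tc cb.
  suff : M * (c - t) <= e by lra.
  by rewrite mulrC -ler_pdivlMr//; rewrite -/c in ct; lra.
move: cb; rewrite le_eqVlt => /predU1P[<-//|cb].
have /near_rightP[d d0 dP] := gr _ ac cb.
pose u := Num.min (c + d / 2) b.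
have cu : c < u by rewrite lt_min cb andbT; lra.
have ud : u < c + d by rewrite gt_min; apply/orP; left; lra.
suff : u <= c by lra.
apply: ub_le_sup => //; split; last exact: (le_trans gc (dP _ cu ud)).
by rewrite (le_trans ac (ltW cu))/= ge_min lexx orbT.
Qed.

(* A substitute for Lebesgue negligibility, for which [psi t] is the measure of
   the part below [t] of an open cover of [E].  Stability under preimages and the
   creeping argument need no measure theory in this form. *)
Definition thin (R : realType) (a b : R) (E : set R) :=
  forall eta, 0 < eta -> exists psi : R -> R,
    [/\ forall s t, a <= s -> s <= t -> t <= b -> psi s <= psi t,
        psi b - psi a <= eta &
        forall t, a <= t -> t < b -> E t ->
          \forall u \near t^'+, u - t <= psi u - psi t].

Lemma thinU (R : realType) (a b : R) (E F : set R) :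
  thin a b E -> thin a b F -> thin a b (E `|` F).
Proof.
move=> tE tF eta eta0; have eta2 : 0 < eta / 2 by lra.
have [p [p1 p2 p3]] := tE _ eta2; have [q [q1 q2 q3]] := tF _ eta2.
exists (fun t => p t + q t); split.
- by move=> s t as_ st tb; rewrite lerD ?p1 ?q1.
- lra.
- move=> t at_ tb EFt.
  have tub : \forall u \near t^'+, t < u <= b.
    by apply/near_rightP; exists (b - t); [lra|move=> u *; lra].
  case: EFt => [Et|Ft].
  + apply: filterS2 (p3 t at_ tb Et) tub => u pu /andP[/ltW tu ub].
    by have := q1 _ _ at_ tu ub; lra.
  + apply: filterS2 (q3 t at_ tb Ft) tub => u qu /andP[/ltW tu ub].
    by have := p1 _ _ at_ tu ub; lra.
Qed.

(** If [p] serves [E] with bound [eta * c], then [p (h t) / c] serves the preimage with bound [eta].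
    The slope bound [c] makes it grow fast enough, and [C] keeps [h u] close to [h t]. *)
Lemma thin_preimage (R : realType) (h : R -> R) (c C a b a' b' : R) (E : set R) :
  0 < c ->
  (forall s t, a <= s -> s <= t -> t <= b ->
    c * (t - s) <= h t - h s <= C * (t - s)) ->
  a' <= h a -> h b <= b' -> a <= b ->
  thin a' b' E -> thin a b (h @^-1` E).
Proof.
move=> c0 hcC ha hb ab tE eta eta0.
have hmono s t : a <= s -> s <= t -> t <= b -> h s <= h t.
  move=> as_ st tb; have /andP[+ _] := hcC _ _ as_ st tb.
  have : 0 <= c * (t - s) by rewrite mulr_ge0 ?subr_ge0// ltW.
  lra.
have [|p [p1 p2 p3]] := tE (eta * c); first by rewrite mulr_gt0.
exists (fun t => p (h t) / c); split.
- move=> s t as_ st tb; rewrite ler_pM2r ?invr_gt0//; apply: p1.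
  + by rewrite (le_trans ha)// hmono// (le_trans st).
  + exact: hmono.
  + by rewrite (le_trans _ hb)// hmono// (le_trans as_).
- rewrite -mulrBl ler_pdivrMr// (le_trans _ p2)//; apply: lerB.
  + by apply: p1 => //; rewrite (le_trans ha)// hmono.
  + by apply: p1 => //; rewrite (le_trans _ hb)// hmono.
- move=> t at_ tb Et.
  have htb' : h t < b'.
    have /andP[+ _] := hcC _ _ at_ (ltW tb) (lexx b).
    have : 0 < c * (b - t) by rewrite mulr_gt0 ?subr_gt0.
    lra.
  have a'ht : a' <= h t by rewrite (le_trans ha)// hmono// ltW.
  have /near_rightP[d d0 dP] := p3 _ a'ht htb' Et.
  have C0 : 0 < C.
    have /andP[] := hcC _ _ at_ (ltW tb) (lexx b) => h1 h2.
    have := le_trans h1 h2; rewrite ler_pM2r ?subr_gt0//.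
    exact: lt_le_trans.
  apply/near_rightP; exists (Num.min (d / C) (b - t)).
    by rewrite lt_min divr_gt0//= subr_gt0.
  move=> u tu; rewrite -ltrBlDl lt_min ltr_pdivlMr// => /andP[ud ub].
  have ub' : u <= b by lra.
  have /andP[h1 h2] := hcC _ _ at_ (ltW tu) ub'.
  have c1 : 0 < c * (u - t) by rewrite mulr_gt0// subr_gt0.
  have := dP (h u); rewrite -mulrBl ler_pdivlMr// => dPu.
  have := dPu ltac:(lra) ltac:(lra); lra.
Qed.

(** Creeping applies to [F t + d * t + K * p t]: off [E] the term [d * t] absorbs the loss, and on
    [E] the term [K * p t] absorbs the worst decrease allowed by the slope bound. *)
Lemma nondecreasing_off_thin (R : realType) (F : R -> R) (K a b : R) (E : set R) :
  a <= b -> 0 <= K -> thin a b E ->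
  (forall s t, a <= s -> s <= t -> t <= b -> F s - K * (t - s) <= F t) ->
  (forall t, a <= t -> t < b -> ~ E t -> forall e, 0 < e ->
     \forall u \near t^'+, F t - e * (u - t) <= F u) ->
  F a <= F b.
Proof.
move=> ab K0 tE FK Fr; apply/ler_addgt0Pr => e e0.
(* With [d = e / M] the two added terms grow by at most [d * (b - a) + K * d <= e]; the summand 1
   keeps [M] positive. *)
pose M := b - a + K + 1.
have M0 : 0 < M by rewrite /M; lra.
have d0 : 0 < e / M by rewrite divr_gt0.
set d := e / M in d0.
have [p [p1 p2 p3]] := tE _ d0.
suff : F a + d * a + K * p a <= F b + d * b + K * p b.
  have : K * (p b - p a) <= K * d by rewrite ler_wpM2l.
  have : d * M = e by rewrite /d divfK// gt_eqF.
  rewrite /M; nra.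
have tub t : t < b -> \forall u \near t^'+, t < u <= b.
  by move=> tb; apply/near_rightP; exists (b - t); [lra|move=> u *; lra].
apply: (@creeping _ (fun t => F t + d * t + K * p t) K) => // [s t as_ st tb|t at_ tb].
  have := FK _ _ as_ st tb; have := p1 _ _ as_ st tb; nra.
have [Et|nEt] := pselect (E t).
  apply: filterS2 (p3 _ at_ tb Et) (tub _ tb) => u pu /andP[tu ub].
  have := FK _ _ at_ (ltW tu) ub; nra.
apply: filterS2 (Fr _ at_ tb nEt _ d0) (tub _ tb) => u Fu /andP[tu ub].
have := p1 _ _ at_ (ltW tu) ub; nra.
Qed.

(** Outer regularity gives an open [U] containing [N] of measure at most [eta]. Just to the right of
    a point of [U], the measure of the part of [U] in []a, t]] grows at rate exactly 1. *)
Lemma thin_negligible (R : realType) (a b : R) (N : set R) :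
  (@lebesgue_measure R).-negligible N -> thin a b N.
Proof.
move=> [A [mA A0' NA]] eta eta0.
pose mu : {measure set (measurableTypeR R) -> \bar R} := @lebesgue_measure R.
have A0 : mu A = 0%E by exact: A0'.
have [|U [oU AU UA]] := lebesgue_regularity_outer mA _ eta0.
  by rewrite -/mu A0 ltry.
have mU : measurable (U : set (measurableTypeR R)) by exact: measurable_realfun.open_measurable.
have Ueta : (mu U <= eta%:E)%E.
  have -> : U = A `|` (U `\` A) by rewrite setUDr setDv setD0; apply/esym/setUidr.
  have : (mu (A `|` (U `\` A)) <= mu A + mu (U `\` A))%E.
    by apply: measureU2 => //; exact: measurableD.
  by move=> /le_trans; apply; rewrite A0 add0e ltW.
pose W t := U `&` `]a, t]%classic.
have muS B C : measurable (B : set (measurableTypeR R)) ->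
  measurable (C : set (measurableTypeR R)) -> B `<=` C -> (mu B <= mu C)%E.
  by move=> mB mC BC; apply: le_measure; rewrite ?inE.
have mW t : measurable (W t : set (measurableTypeR R)) by apply: measurableI.
have Wfin t : mu (W t) \is a fin_num.
  rewrite ge0_fin_numE// (@le_lt_trans _ _ eta%:E)// ?ltry//.
  by apply: le_trans Ueta; apply: muS => //; exact: subIsetl.
exists (fun t => fine (mu (W t))); split.
- move=> s t as_ st tb; apply: fine_le => //.
  apply: muS => //; apply: setIS => z /=.
  by rewrite !in_itv /= => /andP[-> /le_trans]; apply.
- suff -> : W a = set0.
    rewrite measure0 subr0 -lee_fin fineK//.
    by apply: le_trans Ueta; apply: muS => //; exact: subIsetl.
  by rewrite -subset0 => z [_] /=; rewrite in_itv /=; lra.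
- move=> t at_ tb Nt.
  have /nbhs_ballP[d d0 dU] : nbhs t U by apply: open_nbhs_nbhs; split => //; exact/AU/NA.
  apply/near_rightP; exists d => // u tu ud.
  have -> : W u = W t `|` `]t, u]%classic.
    apply/seteqP; split => z; rewrite /W /= !in_itv /=.
      move=> [Uz /andP[az zu]]; have [zt|tz] := leP z t; [left|right]; last lra.
      by rewrite az.
    move=> [[Uz /andP[-> zt]]|/andP[tz zu]]; first by split => //; lra.
    by split; [apply: dU; rewrite /ball /= ltr_distlC; lra|lra].
  have e : mu `]t, u]%classic = (u - t)%:E.
    by have := lebesgue_measure_itv `]t, u]; rewrite /= lte_fin tu; exact.
  suff -> : mu (W t `|` `]t, u]%classic) = (mu (W t) + mu `]t, u]%classic)%E.
      by rewrite e fineD// [leRHS]addrC addKr.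
  apply: measureU => //; apply/seteqP; split => // z [[_]] /=.
  by rewrite !in_itv /=; lra.
Qed.

(** * Travel times for an autonomous equation *)

(** The equation [x' = w(x)] almost everywhere, as a right-hand expansion fit for
    [nondecreasing_off_thin]. The slope bounds replace absolute continuity and, for [b > 0], make
    [x] invertible. *)
Definition solution_on (R : realType) (w : R -> R) (b L T : R) (x : R -> R) :=
  [/\ forall s t, 0 <= s -> s <= t -> t <= T -> b * (t - s) <= x t - x s <= L * (t - s),
      forall t, 0 <= t -> t < T -> b <= w (x t)
    & exists2 N, (@lebesgue_measure R).-negligible N &
      forall t, 0 <= t -> t < T -> ~ N t -> forall e, 0 < e ->
        \forall u \near t^'+, `|x u - x t - w (x t) * (u - t)| <= e * (u - t)].

Lemma solution_reaches (R : realType) (w : R -> R) (b L T : R) (x : R -> R) (s t z : R) :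
  solution_on w b L T x -> 0 < b -> 0 <= s -> s <= t -> t <= T -> x s <= z <= x t ->
  exists2 r, s <= r <= t & x r = z.
Proof.
move=> [xL _ _] b0 s0 st tT xz.
have mono u r : 0 <= u -> u <= r -> r <= T -> x u <= x r.
  move=> u0 ur rT; have /andP[+ _] := xL _ _ u0 ur rT.
  have : 0 <= b * (r - u) by rewrite mulr_ge0 ?subr_ge0// ltW.
  lra.
have cx : {within `[s, t], continuous x}.
  apply/subspace_continuousP => r; rewrite /= in_itv /= => /andP[sr rt].
  apply/cvgrPdist_le => e e0; apply/nbhs_ballP.
  have C0 : 0 < `|L| + 1 by rewrite ltr_pwDr.
  exists (e / (`|L| + 1)); first exact: divr_gt0.
  move=> u; rewrite /ball /= ltr_pdivlMr// in_itv /= => ru /andP[su ut].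
  apply: le_trans (ltW ru); wlog ur : u r sr rt su ut {ru} / u <= r => [W|].
    have [ur|/ltW ur] := leP u r; first exact: W.
    by rewrite distrC [in leRHS]distrC; exact: W.
  have /andP[_ xu] := xL u r ltac:(lra) ur ltac:(lra).
  have := mono u r ltac:(lra) ur ltac:(lra).
  rewrite -subr_ge0 => /ger0_norm ->; rewrite (ger0_norm (x := r - u)) ?subr_ge0//.
  apply: le_trans xu _; rewrite mulrC ler_wpM2l ?subr_ge0//.
  by rewrite (le_trans (ler_norm L))// lerDl.
have [|r] := IVT st cx (v := z).
  by rewrite min_l ?max_r ?mono.
by rewrite in_itv /= => rst xr; exists r.
Qed.

(** Let [h t] be the time at which [x] is where [y] is at time [t]. Both move there with speed
    [w (y t)], so [h] has slope 1 off a thin set. It suffices that [h t - t] is nondecreasing. *)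
Lemma elapsed_le (R : realType) (w : R -> R) (b Lx Ly Tx Ty s0 s1 : R) (x y : R -> R) :
  0 < b -> solution_on w b Lx Tx x -> solution_on w b Ly Ty y ->
  0 <= s0 -> s0 <= s1 -> s1 <= Tx -> 0 <= Ty -> x s0 = y 0 -> x s1 = y Ty ->
  Ty <= s1 - s0.
Proof.
move=> b0 solx soly s00 s01 s1T; rewrite le_eqVlt => /predU1P[<- *|Ty0 xs0 xs1].
  by rewrite subr_ge0.
have [xL wx [Nx Nx0 xN]] := solx; have [yL wy [Ny Ny0 yN]] := soly.
have ymono s t : 0 <= s -> s <= t -> t <= Ty -> y s <= y t.
  move=> as_ st tb; have /andP[+ _] := yL _ _ as_ st tb.
  have : 0 <= b * (t - s) by rewrite mulr_ge0 ?subr_ge0// ltW.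
  lra.
(* Outside [[0, Ty]] the value 0 is a mere placeholder. *)
have /choice[h hE] : forall t, exists r,
    0 <= t -> t <= Ty -> s0 <= r <= s1 /\ x r = y t.
  move=> t; have [t0|t0] := leP 0 t; last by exists 0; lra.
  have [tT|tT] := leP t Ty; last by exists 0; lra.
  have [|r] := solution_reaches (z := y t) solx b0 s00 s01 s1T.
    by rewrite xs0 xs1 !ymono.
  by exists r.
have hS s t : 0 <= s -> s <= t -> t <= Ty ->
    [/\ h s <= h t, b * (h t - h s) <= y t - y s & y t - y s <= Lx * (h t - h s)].
  move=> s0' st tT.
  have [/andP[hs0 hs1] xs] := hE s s0' (le_trans st tT).
  have [/andP[ht0 ht1] xt] := hE t (le_trans s0' st) tT.
  have hst : h s <= h t.
    rewrite leNgt; apply/negP => hts.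
    have /andP[+ _] := xL (h t) (h s) ltac:(lra) (ltW hts) ltac:(lra).
    have := ymono s t s0' st tT.
    have : 0 < b * (h s - h t) by rewrite mulr_gt0 ?subr_gt0.
    lra.
  have /andP[] := xL (h s) (h t) ltac:(lra) hst ltac:(lra).
  by rewrite xs xt.
have Lx0 : 0 < Lx.
  have [h0 _ hT] := hS 0 Ty (lexx 0) (ltW Ty0) (lexx _).
  have /andP[+ _] := yL 0 Ty (lexx _) (ltW Ty0) (lexx _).
  have : 0 < b * (Ty - 0) by rewrite subr0 mulr_gt0.
  nra.
have Ly0 : 0 < Ly.
  have /andP[+ +] := yL 0 Ty (lexx _) (ltW Ty0) (lexx _).
  have : 0 < b * (Ty - 0) by rewrite subr0 mulr_gt0.
  nra.
(* Both slope bounds on [h] are needed to pull the exceptional set [Nx] back along [h]. *)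
have hL s t : 0 <= s -> s <= t -> t <= Ty ->
    b / Lx * (t - s) <= h t - h s <= Ly / b * (t - s).
  move=> s0' st tT; have [h1 h2 h3] := hS _ _ s0' st tT.
  have /andP[y1 y2] := yL _ _ s0' st tT.
  rewrite mulrAC ler_pdivrMr// [in X in _ && X]mulrAC ler_pdivlMr//.
  by apply/andP; split; lra.
have h0E : h 0 = s0.
  have [/andP[h1 h2] h3] := hE 0 (lexx _) (ltW Ty0).
  have /andP[+ _] := xL s0 (h 0) s00 h1 (le_trans h2 s1T).
  rewrite xs0 h3 subrr; nra.
have [/andP[hT1 hT2] _] := hE Ty (ltW Ty0) (lexx _).
suff : h 0 - 0 <= h Ty - Ty by lra.
apply: (@nondecreasing_off_thin _ (fun t => h t - t) 1 0 Ty (h @^-1` Nx `|` Ny)).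
- exact: ltW.
- exact: ler01.
- apply: thinU; last exact: thin_negligible.
  apply: (thin_preimage (divr_gt0 b0 Lx0) hL (lexx _) (lexx _) (ltW Ty0)).
  exact: thin_negligible.
- move=> s t s0' st tT; have [h1 _ _] := hS _ _ s0' st tT; lra.
move=> t t0 tT /not_orP[nNx nNy] e e0.
have [/andP[ht1 ht2] xht] := hE t t0 (ltW tT).
(* The expansion of [x] is available only before [Tx]; [h t = h Ty] would contradict the strict
   growth of [y]. *)
have htT : h t < Tx.
  have [+ h2 _] := hS t Ty t0 (ltW tT) (lexx _).
  rewrite le_eqVlt => /predU1P[hh|]; last lra.
  have /andP[+ _] := yL t Ty t0 (ltW tT) (lexx _).
  have [_ +] := hE Ty (ltW Ty0) (lexx _).
  rewrite -hh xht => ->; rewrite subrr.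
  have : 0 < b * (Ty - t) by rewrite mulr_gt0 ?subr_gt0.
  lra.
have wb := wy t t0 tT.
(* As [b <= W] for the common speed [W], this choice gives [(W + d) * (1 - e) <= W - d], which turns
   the two expansions into [(1 - e) * (u - t) <= h u - h t]. *)
pose d := b * e / 2.
have d0 : 0 < d by rewrite /d divr_gt0// mulr_gt0.
have /near_rightP[r1 r10 xr] := xN (h t) ltac:(lra) htT nNx _ d0.
have /near_rightP[r2 r20 yr] := yN t t0 tT nNy _ d0.
(* The middle radius keeps [h u] within [r1] of [h t], since [h] has slope at most [Ly / b]. *)
apply/near_rightP; exists (Num.min r2 (Num.min (r1 / (Ly / b)) (Ty - t))).
  by rewrite !lt_min r20 divr_gt0 ?subr_gt0// divr_gt0.
move=> u tu; rewrite -ltrBlDl !lt_min => /and3P[u1 u2 u3].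
have uT : u <= Ty by lra.
have [_ _ hu] := hS t u t0 (ltW tu) uT.
have /andP[hu1 hu2] := hL t u t0 (ltW tu) uT.
have htu : h t < h u.
  have : 0 < b / Lx * (u - t) by rewrite mulr_gt0 ?subr_gt0// divr_gt0.
  lra.
have := yr u tu ltac:(lra); rewrite ler_norml => /andP[yu _].
have := xr (h u) htu; rewrite xht ler_norml => /(_ _)/andP[].
  by move: u2; rewrite ltr_pdivlMr ?divr_gt0//; lra.
have [_ ->] := hE u ltac:(lra) uT.
move=> _ xu.
set W := w (y t) in wb yu xu.
have {xu yu} : (W - d) * (u - t) <= (W + d) * (h u - h t) by lra.
have : (W + d) * (1 - e) <= W - d.
  have : b * e <= W * e by rewrite ler_pM2r.
  have : 0 <= d * e by rewrite mulr_ge0 ?ltW.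
  rewrite /d; nra.
nra.
Qed.

(** By contraposition: if [x] gets as far as [y Ty], it covers the whole route of [y] between times
    [s0] and [s1] of [[0, Tx]], so [Ty <= s1 - s0 <= Tx]. If it gets strictly farther, then
    [s1 < Tx]. *)
Lemma solution_le (R : realType) (w : R -> R) (b Lx Ly Tx Ty : R) (x y : R -> R) :
  0 < b -> solution_on w b Lx Tx x -> solution_on w b Ly Ty y ->
  0 <= Tx -> Tx <= Ty -> x 0 <= y 0 ->
  x Tx <= y Ty /\ (Tx < Ty -> x Tx < y Ty).
Proof.
move=> b0 solx soly Tx0 Txy xy0; have Ty0 := le_trans Tx0 Txy.
have [xL _ _] := solx; have [yL _ _] := soly.
suff main : y Ty <= x Tx -> Ty <= Tx /\ (y Ty < x Tx -> Ty < Tx).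
  have [|xy] := leP (y Ty) (x Tx); last by rewrite ltW.
  move=> /[dup] /main[TT H]; rewrite le_eqVlt => /predU1P[->|/H]; last lra.
  by split=> //; lra.
move=> yx.
have /andP[yy _] := yL 0 Ty (lexx _) Ty0 (lexx _).
have y0x : y 0 <= x Tx by nra.
have [|s0 /andP[s00 s0T] xs0] := solution_reaches (z := y 0) solx b0 (lexx 0) Tx0 (lexx _).
  by rewrite xy0.
have [|s1 /andP[s01 s1T] xs1] := solution_reaches (z := y Ty) solx b0 s00 s0T (lexx _).
  by rewrite xs0 yx andbT; nra.
have := elapsed_le b0 solx soly s00 s01 s1T Ty0 xs0 xs1.
split; first lra.
move=> yltx; suff : s1 < Tx by lra.
by rewrite lt_neqAle s1T andbT; apply: contraTneq yltx => <-; rewrite xs1 ltxx.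
Qed.

(** * From trajectories at a fixed point to unblocked solutions *)

Lemma derivable_near_right (R : realType) (f : R -> R) (t e : R) :
  derivable f t 1 -> 0 < e ->
  \forall u \near t^'+, `|f u - f t - derive1 f t * (u - t)| <= e * (u - t).
Proof.
move=> df e0.
have : h^-1 *: (f (h + t) - f t) @[h --> 0^'] --> derive1 f t.
  have -> : (fun h : R => h^-1 *: (f (h + t) - f t)) =
            (fun h : R => h^-1 *: ((f \o shift t) (h *: (1 : R)) - f t)).
    by apply/funext => h /=; rewrite [h *: 1]mulr1.
  by rewrite derive1E; exact: df.
move=> /cvgrPdist_le /(_ _ e0) /nbhs_ballP[d d0 dP].
apply/near_rightP; exists d => // u tu ud.
have ut0 : 0 < u - t by rewrite subr_gt0.
have := dP (u - t); rewrite /ball /= sub0r normrN gtr0_norm// => /(_ _ _).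
rewrite subrK => H.
have := H ltac:(lra) (lt0r_neq0 ut0).
rewrite distrC -ler_pdivrMr// => le_e.
apply: le_trans le_e; rewrite -[X in _ / X]gtr0_norm// -normf_div.
by rewrite mulrBl mulfK ?lt0r_neq0// [_ *: _]mulrC.
Qed.

Lemma lipschitz_itv_bound (R : realType) (f : R -> R) :
  [lipschitz f t | t in `[0, +oo[] ->
  exists L, forall s t, 0 <= s -> s <= t -> `|f t - f s| <= L * (t - s).
Proof.
case=> M [_ /(_ (M + 1))]; rewrite ltrDl ltr01 => /(_ isT) fM.
exists (M + 1) => s t s0 st.
have := fM (t, s) _; rewrite /= (ger0_norm (x := t - s)) ?subr_ge0//; apply.
by rewrite !in_itv /= !andbT (le_trans s0).
Qed.

Lemma start_state_ahead (R : realType) (m : nat) (p : 'rV[R]_m) (j : 'I_m) :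
  start_state p (ahead j) = p ord0 j.
Proof. by rewrite /start_state /ahead liftK. Qed.

Lemma start_state0 (R : realType) (m : nat) (p : 'rV[R]_m) : start_state p ord0 = 0.
Proof. by rewrite /start_state unlift_none. Qed.

Lemma aheadP (m : nat) (i : 'I_m.+1) : i = ord0 \/ exists j : 'I_m, i = ahead j.
Proof.
have [j ->|->] := unliftP ord0 i; last by left.
by right; exists j.
Qed.

Lemma behindP (m : nat) (i : 'I_m.+1) : i = ord_max \/ exists j : 'I_m, i = behind j.
Proof.
have [im|im] := ltnP i m.
  by right; exists (Ordinal im); apply: val_inj.
by left; apply: val_inj => /=; apply/eqP; rewrite eqn_leq im -ltnS ltn_ord.
Qed.

(** Induction from the last worker backwards, [k] being the number of workers ahead: a blocked
    worker moves at the minimum of two speeds that are at least [b]. *)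
Lemma trajectory_speed (R : realType) (m : nat) (v x : 'I_m.+1 -> R -> R) (b t : R) :
  (forall i, b <= v i (x i t)) ->
  derive1 (x ord_max) t = v ord_max (x ord_max t) ->
  (forall j : 'I_m, derive1 (x (behind j)) t =
     if x (behind j) t < x (ahead j) t then v (behind j) (x (behind j) t)
     else Num.min (v (behind j) (x (behind j) t)) (derive1 (x (ahead j)) t)) ->
  forall i, b <= derive1 (x i) t.
Proof.
move=> vb dmax dbehind.
suff main k (i : 'I_m.+1) : (i + k = m)%N -> b <= derive1 (x i) t.
  by move=> i; apply: (main (m - i)%N); rewrite subnKC// -ltnS.
elim: k i => [|k IH] i ik.
  have -> : i = ord_max by apply: val_inj; move: ik; rewrite addn0.
  by rewrite dmax.
have [im|[j ij]] := behindP i.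
  by move: ik; rewrite im /=; lia.
rewrite ij dbehind; case: ifP => _ //.
rewrite le_min vb IH//= /bump /=.
by move: ik; rewrite ij /=; lia.
Qed.

Lemma fixed_point_solution (R : realType) (m : nat) (v : 'I_m.+1 -> R -> R) (b B : R)
    (p : 'rV[R]_m) :
  0 < b -> (forall i (x : R), x \in `[0, 1] -> b < v i x < B) ->
  resets_to v p p ->
  exists x T, [/\ 0 <= T, x ord_max T = 1, x ord0 0 = 0,
    forall j : 'I_m, x (ahead j) 0 = p ord0 j /\ x (behind j) T = p ord0 j
  & forall i, exists L, solution_on (v i) b L T (x i)].
Proof.
move=> b_gt0 vbB [x [T [[xlip xline xode] x0 [T0 xT Tmin] pT]]].
have x01 i t : 0 <= t -> x i t \in `[0, 1].
  by move=> t0; rewrite in_itv /=; have [+ _] := xline t t0; apply.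
have xlt1 t : 0 <= t -> t < T -> x ord_max t < 1.
  move=> t0 tT; have := x01 ord_max t t0; rewrite in_itv /= => /andP[_].
  rewrite le_eqVlt => /predU1P[/(Tmin _ t0)|//]; lra.
have vb i t : 0 <= t -> b <= v i (x i t).
  by move=> t0; have /andP[/ltW] := vbB i _ (x01 i t t0).
have [N N0 xN] : exists2 N, (@lebesgue_measure R).-negligible N &
  forall t, 0 <= t -> t < T -> ~ N t ->
    [/\ forall i, derivable (x i) t 1,
            derive1 (x ord_max) t = v ord_max (x ord_max t)
          & forall j : 'I_m,
              derive1 (x (behind j)) t =
                if x (behind j) t < x (ahead j) t then v (behind j) (x (behind j) t)
                else Num.min (v (behind j) (x (behind j) t)) (derive1 (x (ahead j)) t)].
  eexists; first exact: xode.
  move=> t t0 tT /contrapT; apply => //; exact: xlt1.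
have /choice[L xL] : forall i, exists L, forall s t, 0 <= s -> s <= t ->
    `|x i t - x i s| <= L * (t - s).
  by move=> i; exact: lipschitz_itv_bound.
(* This bound is proved while blocking is still possible, because it is what excludes blocking
   below. *)
have xb i s t : 0 <= s -> s <= t -> t <= T -> b * (t - s) <= x i t - x i s.
  move=> s0 st tT.
  suff : x i s - b * s <= x i t - b * t by lra.
  apply: (@nondecreasing_off_thin _ (fun t => x i t - b * t) (`|L i| + b) s t N) => //.
  - by rewrite addr_ge0// ltW.
  - exact: thin_negligible.
  - move=> r u sr ru ut; have := xL i r u ltac:(lra) ru.
    rewrite ler_norml => /andP[+ _].
    have : L i * (u - r) <= `|L i| * (u - r).
      by rewrite ler_wpM2r ?subr_ge0// ler_norm.
    lra.
  move=> r sr rt nNr e e0.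
  have [xd xm xbe] := xN r ltac:(lra) ltac:(lra) nNr.
  have /near_rightP[d d0 dP] := derivable_near_right (xd i) e0.
  apply/near_rightP; exists d => // u ru ud.
  have := dP u ru ud; rewrite ler_norml => /andP[+ _].
  have := trajectory_speed (fun i => vb i r ltac:(lra)) xm xbe i.
  set D := derive1 _ _ => bD.
  have : b * (u - r) <= D * (u - r) by rewrite ler_wpM2r ?subr_ge0// ltW.
  lra.
have aheadE j : x (ahead j) 0 = x (behind j) T.
  by rewrite x0 start_state_ahead pT.
exists x, T; split => //; first by rewrite x0 start_state0.
  by move=> j; rewrite x0 start_state_ahead pT.
move=> i; exists (L i); split.
- move=> s t s0 st tT; rewrite xb//=.
  exact: le_trans (ler_norm _) (xL i s t s0 st).
- by move=> t t0 _; exact: vb.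
exists N => // t t0 tT nNt e e0.
have [xd xm xbe] := xN t t0 tT nNt.
suff <- : derive1 (x i) t = v i (x i t) by exact: derivable_near_right.
have [->//|[j ->]] := behindP i.
(* Worker j is still short of his position at the reset, where worker j+1 started. *)
rewrite xbe ifT//.
have := xb (behind j) t T t0 (ltW tT) (lexx _).
have := xb (ahead j) 0 t (lexx _) t0 (ltW tT).
have : 0 < b * (T - t) by rewrite mulr_gt0 ?subr_gt0.
have : 0 <= b * (t - 0) by rewrite subr0 mulr_ge0// ltW.
rewrite aheadE; lra.
Qed.

(** * Comparison of two fixed points *)

Lemma fixed_point_le (R : realType) (m : nat) (v x y : 'I_m.+1 -> R -> R) (b S T : R) :
  0 < b -> 0 <= S -> S <= T ->
  x ord0 0 = 0 -> y ord0 0 = 0 ->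
  (forall j : 'I_m, x (ahead j) 0 = x (behind j) S) ->
  (forall j : 'I_m, y (ahead j) 0 = y (behind j) T) ->
  (forall i, exists L, solution_on (v i) b L S (x i)) ->
  (forall i, exists L, solution_on (v i) b L T (y i)) ->
  forall i, x i S <= y i T /\ (S < T -> x i S < y i T).
Proof.
move=> b_gt0 S0 ST x0 y0 xS yT solx soly.
suff main k (i : 'I_m.+1) : i = k :> nat -> x i S <= y i T /\ (S < T -> x i S < y i T).
  by move=> i; exact: main.
elim: k i => [|k IH] i ik; have [Lx sx] := solx i; have [Ly sy] := soly i;
    apply: (solution_le b_gt0 sx sy S0 ST).
  have -> : i = ord0 by exact: val_inj.
  by rewrite x0 y0.
have [i0|[j ij]] := aheadP i; first by move: ik; rewrite i0.
(* Only the weak inequality is passed on as the comparison of starting points; strictness comes anew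
   for each worker from [S < T]. *)
rewrite ij xS yT; apply: (IH (behind j) _).1.
by move: ik; rewrite ij /= /bump /= add1n => -[].
Qed.

Theorem theorem1p1 (R : realType) (m : nat) (n_ge2 : (2 <= m.+1)%N)
    (v : 'I_m.+1 -> R -> R)
    (v_cont : forall i, ae_continuous01 (v i))
    (v_bounds : exists b B : R, 0 < b /\
       forall i (x : R), x \in `[0, 1] -> b < v i x < B)
    (f : {fun @triangle R m >-> @triangle R m})
    (f_reset : is_reset_function v f)
    (p q : 'rV[R]_m) (p_in : triangle p) (q_in : triangle q)
    (fp : f p = p) (fq : f q = q) :
  p = q.
Proof.
have [b [B [b0 vbB]]] := v_bounds.
have := f_reset p p_in; rewrite fp => rp.
have := f_reset q q_in; rewrite fq => rq.
have [x [S [S0 xS x0 xp xsol]]] := fixed_point_solution b0 vbB rp.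
have [y [T [T0 yT y0 yq ysol]]] := fixed_point_solution b0 vbB rq.
have xaS j : x (ahead j) 0 = x (behind j) S by have [-> ->] := xp j.
have yaT j : y (ahead j) 0 = y (behind j) T by have [-> ->] := yq j.
have xy ST := fixed_point_le b0 S0 ST x0 y0 xaS yaT xsol ysol.
have yx TS := fixed_point_le b0 T0 TS y0 x0 yaT xaS ysol xsol.
have ST : S = T.
  apply/eqP; rewrite eq_le !leNgt; apply/andP; split; apply/negP => lt.
    by have [_ /(_ lt)] := yx (ltW lt) ord_max; rewrite xS yT ltxx.
  by have [_ /(_ lt)] := xy (ltW lt) ord_max; rewrite xS yT ltxx.
apply/rowP => j; have [_ <-] := xp j; have [_ <-] := yq j.
by apply/eqP; rewrite eq_le (xy _ _).1 ?(yx _ _).1 ?ST.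
Qed.
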